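(* Consider a two-player zero-sum stopping game with payoff processes $X,Y,Z$. Let $\tau_1,\tau_1'$ be equivalent random stopping times of Player 1 (each mixed, randomized or distribution) and let $\tau_2,\tau_2'$ be equivalent random stopping times of Player 2 (each mixed, randomized or distribution). Then $$\gamma(X,Y,Z;\tau_1,\tau_2)=\gamma(X,Y,Z;\tau_1',\tau_2').$$ That is, the payoff in the stopping game depends on the players' random stopping times only through their equivalence classes.
   Context: $T>0$; $I=[0,1]$ is equipped with its Borel $\sigma$-algebra $\mathcal{B}$ and Lebesgue measure $\lambda$; $\mathcal{B}_T$ is the Borel $\sigma$-algebra of $[0,T]$. $(\Omega,\mathcal{F},P)$ is a probability space with a filtration $(\mathcal{F}_t)_{t\in[0,T]}$ satisfying the usual conditions: $\mathcal{F}=\bigvee_{t}\mathcal{F}_t$; $\mathcal{F}_0$ contains all $P$-null sets; $\mathcal{F}_t=\bigcap_{s>t}\mathcal{F}_s$. In the definitions of stopping times, measurability with respect to a $\sigma$-algebra means with respect to its completion under the underlying measure. A mixed stopping time is a function $\mu:\Omega\times I\to[0,T]$ such that $\{(\omega,r):\mu(\omega,r)\le t\}$ is $(\mathcal{F}_t\otimes\mathcal{B})$-measurable for every $t\in[0,T]$. A randomized stopping time is an adapted $[0,1]$-valued process $\rho=(\rho_t)_{t\in[0,T]}$ with right-continuous nondecreasing paths and $\rho_T\equiv 1$. A distribution stopping time is a probability measure $\delta$ on $(\Omega\times[0,T],\mathcal{F}\otimes\mathcal{B}_T)$ whose marginal on $\Omega$ is $P$ and such that for every $t\in[0,T]$ the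 Radon-Nikodym derivative with respect to $P$ of $A\mapsto\delta(A\times[0,t])$ is $\mathcal{F}_t$-measurable. A mixed stopping time $\mu$ defines the distribution stopping time $\delta_\mu$, the push-forward of $P\otimes\lambda$ under $(\omega,r)\mapsto(\omega,\mu(\omega,r))$; a randomized stopping time $\rho$ defines $\delta_\rho$ by $\delta_\rho(A\times[0,t])=\int_A\rho_t\,dP$ for all $t\in[0,T]$, $A\in\mathcal{F}$; for a distribution stopping time $\delta$ put $\delta_\delta=\delta$. Random stopping times $\eta_1,\eta_2$ are equivalent if $\delta_{\eta_1}=\delta_{\eta_2}$. A two-player zero-sum stopping game is given by three bounded real-valued $\mathcal{F}\otimes\mathcal{B}_T$-measurable payoff processes $X=(X_t)$, $Y=(Y_t)$, $Z=(Z_t)$, $t\in[0,T]$, giving the payoff when Player 1 stops before, after, or together with Player 2, respectively; Player 1 maximizes and Player 2 minimizes the expected payoff. Payoff: let $\delta_2$ be the distribution stopping time defined by Player 2's random stopping time $\tau_2$. On $\tilde\Omega=\Omega\times[0,T]$ with $\sigma$-algebra $\mathcal{F}\otimes\mathcal{B}_T$, probability measure $\delta_2$ and filtration $\tilde{\mathcal{F}}_t=\{A\times[0,T]:A\in\mathcal{F}_t\}$, put $$R_t(\omega,s)=X_t(\omega)\mathbf{1}_{t<s}+Y_s(\omega)\mathbf{1}_{t>s}+Z_t(\omega)\mathbf{1}_{t=s}.$$ The payoff $\gamma(X,Y,Z;\tau,\tau_2)$ when Player 1 uses $\tau$ is the payoff of the lift $\tilde\tau$ of $\tau$ to $\tilde\Omega$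 in the one-player stopping problem with payoff process $R$, as follows. (i) If $\tau=\mu$ is a mixed stopping time, its lift is $\tilde\mu(\omega,s,r)=\mu(\omega,r)$ and $\gamma(X,Y,Z;\mu,\tau_2)=\mathbf{E}_{\delta_2\otimes\lambda}[R_{\tilde\mu(\omega,s,r)}(\omega,s)]$. (ii) If $\tau=\rho$ is a randomized stopping time, its lift is $\tilde\rho_t(\omega,s)=\rho_t(\omega)$ and $\gamma(X,Y,Z;\rho,\tau_2)=\mathbf{E}_{\delta_2}\left[\int_{[0,T]}R_t(\omega,s)\,d\tilde\rho_t(\omega,s)\right]$, the integral including the atom of mass $\tilde\rho_0$ at $t=0$. (iii) If $\tau=\delta$ is a distribution stopping time, with conditional distributions $\nu_\omega$ on $[0,T]$ given $\omega$ (so $\delta(d\omega,dt)=P(d\omega)\,\nu_\omega(dt)$), its lift is the probability measure $\tilde\delta(d\omega,ds,dt)=\delta_2(d\omega,ds)\,\nu_\omega(dt)$ on $\tilde\Omega\times[0,T]$, and $\gamma(X,Y,Z;\delta,\tau_2)=\mathbf{E}_{\tilde\delta}[R_t(\omega,s)]$. *)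

(* Defs.v *)
From HB Require Import structures.
From mathcomp Require Import all_boot all_order all_algebra.
From mathcomp Require Import all_classical all_reals all_analysis.
From mathcomp Require Import measurable_realfun.

Set Implicit Arguments.
Unset Strict Implicit.
Unset Printing Implicit Defensive.

Import Order.TTheory GRing.Theory Num.Theory.
Import numFieldNormedType.Exports.

Local Open Scope classical_set_scope.
Local Open Scope charge_scope.
Local Open Scope ring_scope.

(* The spaces [0, T] and I = [0, 1] are the corresponding
   intervals of R: a process indexed by [0, T] is a function of a real time of
   which only the values on [0, T] matter, a measure on Omega x [0, T] is a
   measure on Omega x R carried by Omega x [0, T], and P (x) lambda is
   P \x lebesgue_measure on subsets of Omega x [0, 1]. *)

(* Completion of the sigma-algebra G under mu restricted to G: the null sets
   that are added are subsets of null sets of G itself.  For G = measurable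
   this is completed_algebra_gen mu. *)
Definition completion {U : Type} {R : realType} (mu : set U -> \bar R)
    (G : set (set U)) : set (set U) :=
  [set A `|` N | A in G &
                 N in [set N | exists B, [/\ G B, mu B = 0%E & N `<=` B]]].

Section stopping_times.
Context {R : realType} (T : R) {d : measure_display} {Omega : measurableType d}
  (P : probability Omega R).

Local Notation real := (measurableTypeR R).

Record usual_conditions (F : R -> set (set Omega)) : Prop := UsualConditions {
  uc_sigma_algebra : forall t, 0 <= t <= T -> sigma_algebra setT (F t) ;
  uc_nondecreasing : forall s t, 0 <= s -> s <= t -> t <= T -> F s `<=` F t ;
  uc_generated : d.-measurable = <<s \bigcup_(t in `[0, T]) F t >> ;
  uc_null_sets : P.-negligible `<=` F 0 ;
  uc_right_continuous : forall t, 0 <= t < T ->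
    F t = \bigcap_(s in `]t, T]) F s
}.

Variable F : R -> set (set Omega).

(* F_t (x) B, as a sigma-algebra of subsets of Omega x [0, 1] *)
Definition prod_unit (t : R) : set (set (Omega * real)) :=
  <<s setT `*` `[0, 1],
      [set A `*` B | A in F t & B in [set B : set real |
                                        measurable B /\ B `<=` `[0, 1]]] >>.

Record mixed_st := MixedST {
  mixed_fun :> Omega -> R -> R ;
  mixed_range : forall w r, 0 <= r <= 1 -> 0 <= mixed_fun w r <= T ;
  mixed_measurable : forall t, 0 <= t <= T ->
    completion (P \x lebesgue_measure)%E (prod_unit t)
      [set p | 0 <= (p.2 : R) <= 1 /\ mixed_fun p.1 p.2 <= t]
}.

Record randomized_st := RandomizedST {
  randomized_proc :> R -> Omega -> R ;
  randomized_range : forall t w, 0 <= t <= T -> 0 <= randomized_proc t w <= 1 ;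
  randomized_adapted : forall t, 0 <= t <= T ->
    forall B : set R, measurable B ->
      completion P (F t) (randomized_proc t @^-1` B) ;
  randomized_nondecreasing : forall w s t, 0 <= s -> s <= t -> t <= T ->
    randomized_proc s w <= randomized_proc t w ;
  randomized_right_continuous : forall w t, 0 <= t < T ->
    randomized_proc ^~ w @ t^'+ --> randomized_proc t w ;
  randomized_end : forall w, randomized_proc T w = 1
}.

Section slice.
Local Open Scope ereal_scope.
Variables (delta : probability (Omega * real)%type R) (t : R).

Definition slice (A : set Omega) : \bar R := delta (A `*` `[0%R, t]).

Let measurable_slice (A : set Omega) :
  measurable A -> measurable (A `*` (`[0%R, t] : set real)).
Proof. by move=> mA; apply: measurableX => //; exact: measurable_itv. Qed.

Let slice0 : slice set0 = 0.
Proof. by rewrite /slice set0X measure0. Qed.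

Let slice_ge0 A : 0 <= slice A. Proof. exact: measure_ge0. Qed.

Let slice_sigma_additive : semi_sigma_additive slice.
Proof.
move=> A mA tA mbigA; rewrite /slice setX_bigcupl.
apply: measure_semi_sigma_additive => [n||]; first exact: measurable_slice.
- apply/trivIsetP => i j _ _ ij; rewrite -setXI.
  by move/trivIsetP : tA => -> //; rewrite set0X.
- by rewrite -setX_bigcupl; exact: measurable_slice.
Qed.

HB.instance Definition _ := isMeasure.Build _ _ _ slice
  slice0 slice_ge0 slice_sigma_additive.

Let slice_fin_num : fin_num_fun slice.
Proof. by move=> A mA; apply: fin_num_measure; exact: measurable_slice. Qed.

HB.instance Definition _ := Measure_isFinite.Build _ _ _ slice slice_fin_num.

End slice.

Record distribution_st := DistributionST {
  distribution_law :> probability (Omega * real)%type R ;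
  distribution_support : distribution_law (setT `*` `[0, T]) = 1%E ;
  distribution_marginal : forall A, measurable A ->
    distribution_law (A `*` setT) = P A ;
  distribution_adapted : forall t, 0 <= t <= T ->
    forall B : set (\bar R), measurable B ->
      completion P (F t)
        ('d (charge_of_finite_measure (slice distribution_law t)) '/d P @^-1` B)
}.

Inductive random_st :=
| Mixed of mixed_st
| Randomized of randomized_st
| Distribution of distribution_st.

(* [defines eta delta]: the random stopping time eta defines the distribution
   stopping time delta.  In the mixed case the preimage of C lies in the
   completion of F (x) B, and its P (x) lambda-measure is that of any A from
   which it differs by a null set. *)
Definition defines (eta : random_st)
    (delta : probability (Omega * real)%type R) : Prop :=
  match eta with
  | Mixed mu => forall C : set (Omega * real), measurable C ->
      exists A N, [/\ measurable A, (P \x lebesgue_measure)%E.-negligible N,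
        [set p : Omega * real | 0 <= (p.2 : R) <= 1 /\ C (p.1, mu p.1 p.2)]
          = A `|` N &
        delta C = (P \x lebesgue_measure)%E A]
  | Randomized rho => forall t, 0 <= t <= T -> forall A, measurable A ->
      delta (A `*` `[0, t]) = (\int[P]_(w in A) (rho t w)%:E)%E
  | Distribution law => forall C, measurable C -> delta C = law C
  end.

(* [defines eta] determines delta on measurable sets; the default value of get
   is never reached under the usual conditions. *)
Definition delta_of (eta : random_st) : probability (Omega * real)%type R :=
  get (defines eta).

Definition equivalent (eta1 eta2 : random_st) : Prop :=
  forall C, measurable C -> delta_of eta1 C = delta_of eta2 C.

Definition payoff_process (X : R -> Omega -> R) : Prop :=
  measurable_fun (setT `*` `[0, T] : set (Omega * real)) (fun p => X p.2 p.1)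
  /\ exists M, forall t w, 0 <= t <= T -> `|X t w| <= M.

(* The path t |-> rho_t(w), extended by 0 before time 0 and by 1 after T, so
   that its Lebesgue-Stieltjes measure has an atom of mass rho_0(w) at 0. *)
Definition ext_path (rho : randomized_st) (w : Omega) (t : R) : R :=
  if t < 0 then 0 else if t < T then rho t w else 1.

Section ext_path_cumulative.
Variables (rho : randomized_st) (w : Omega).

Let ext_path_nondecreasing : nondecreasing (ext_path rho w).
Proof.
move=> s t st; rewrite /ext_path.
have rng u : 0 <= u -> u < T -> 0 <= rho u w <= 1.
  by move=> u0 uT; apply: randomized_range; rewrite u0 ltW.
have [s0|s0] := ltP s 0.
  have [//|t0] := ltP t 0; have [tT|//] := ltP t T.
  by have /andP[] := rng _ t0 tT.
rewrite (ltNge t 0) (le_trans s0 st)/=.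
have [tT|Tt] := ltP t T.
  rewrite (le_lt_trans st tT).
  by apply: randomized_nondecreasing => //; exact: ltW.
by have [sT|//] := ltP s T; have /andP[] := rng _ s0 sT.
Qed.

Let ext_path_right_continuous : right_continuous (ext_path rho w).
Proof.
move=> t.
have [t0|t0] := ltP t 0.
  have -> : ext_path rho w t = 0 by rewrite /ext_path t0.
  apply: cvg_near_cst; near=> u.
  have u0 : u < 0 by near: u; exact: nbhs_right_lt.
  by rewrite /ext_path u0.
have [tT|Tt] := ltP t T.
  have -> : ext_path rho w t = rho t w by rewrite /ext_path (ltNge t 0) t0 tT.
  have t0T : 0 <= t < T by rewrite t0.
  have := @randomized_right_continuous rho w t t0T.
  apply: cvg_trans; apply: near_eq_cvg; near=> u.
  have tu : t < u by near: u; exact: nbhs_right_gt.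
  have uT : u < T by near: u; exact: nbhs_right_lt.
  by rewrite /ext_path (ltNge u 0) (le_trans t0 (ltW tu))/= uT.
have -> : ext_path rho w t = 1 by rewrite /ext_path (ltNge t 0) (ltNge t T) t0 Tt.
apply: cvg_near_cst; near=> u.
have tu : t < u by near: u; exact: nbhs_right_gt.
by rewrite /ext_path (ltNge u 0) (ltNge u T) (le_trans t0 (ltW tu)) (le_trans Tt (ltW tu)).
Unshelve. all: by end_near. Qed.

HB.instance Definition _ := isCumulative.Build R _ R (ext_path rho w)
  ext_path_nondecreasing ext_path_right_continuous.

End ext_path_cumulative.

(* nu is a version of the conditional distributions on [0, T] given w of
   delta(dw, dt) = P(dw) nu_w(dt). *)
Definition conditional_distributions
    (delta : probability (Omega * real)%type R)
    (nu : Omega -> probability real R) : Prop :=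
  [/\ forall B, measurable B -> measurable_fun setT (fun w => nu w B),
      forall w, nu w `[0, T]%classic = 1%E &
      forall A B, measurable A -> measurable B ->
        delta (A `*` B) = (\int[P]_(w in A) nu w B)%E].

(* a choice of version; one exists for every distribution stopping time *)
Definition conditional (delta : probability (Omega * real)%type R) :
    Omega -> probability real R :=
  get (conditional_distributions delta).

(* delta2(dw, ds) nu_w(dt), in the way the library defines product measures *)
Definition lift_law (delta2 : probability (Omega * real)%type R)
    (nu : Omega -> probability real R) (C : set ((Omega * real) * real)) :
    \bar R :=
  (\int[delta2]_p nu p.1 (xsection C p))%E.

Section payoff.
Variables X Y Z : R -> Omega -> R.

Definition stopped_payoff (t : R) (w : Omega) (s : R) : R :=
  if t < s then X t w else if s < t then Y s w else Z t w.

(* The integrand of the first case is measurable for the completion of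
   (F (x) B_T) (x) B only; the library's integral of such a bounded function,
   a difference of suprema over simple functions, is its integral for the
   completed measure. *)
Definition gamma (tau tau2 : random_st) : \bar R :=
  let delta2 := delta_of tau2 in
  match tau with
  | Mixed mu =>
      (\int[delta2 \x lebesgue_measure]_(p in (setT `*` `[0%R, T]) `*` `[0%R, 1%R])
        (stopped_payoff (mu p.1.1 p.2) p.1.1 p.1.2)%:E)%E
  | Randomized rho =>
      (\int[delta2]_(p in setT `*` `[0%R, T])
        \int[lebesgue_stieltjes_measure (ext_path rho p.1)]_(t in `[0%R, T])
          (stopped_payoff t p.1 p.2)%:E)%E
  | Distribution delta =>
      (\int[lift_law delta2 (conditional delta)]_(p in
          (setT `*` `[0%R, T]) `*` `[0%R, T])
        (stopped_payoff p.2 p.1.1 p.1.2)%:E)%E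
  end.

End payoff.
End stopping_times.

(* Main.v *)
Require Import Defs.
From HB Require Import structures.
From mathcomp Require Import all_boot all_order all_algebra.
From mathcomp Require Import all_classical all_reals all_analysis.
From mathcomp Require Import measurable_realfun lra.

(** The three kinds of random stopping times give one and the same formula for
    the payoff. Let delta_1 and delta_2 be the laws defined by tau_1 and tau_2,
    and let nu_w be the conditional distributions of delta_1 given w. Then
    gamma is the iterated integral

      E_(delta_2) [ int_[0,T] R_t(w, s) nu_w(dt) ]

    (iterated_payoff, gamma_iterated_payoff). It depends on delta_2 only
    through its values on measurable sets. It depends on nu only up to a P-null
    set of w, because the marginal of delta_2 on Omega is P; and up to such a
    set nu is determined by the values of delta_1 on measurable sets
    (conditional_distributions_unique, eq_iterated_payoff).

    For a randomized stopping time, nu_w is the Lebesgue-Stieltjes measure of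
    the path, and the formula is the definition of the payoff. For a
    distribution stopping time, nu comes from a disintegration of delta_1 along
    P, built from Radon-Nikodym derivatives at rational times (disintegration),
    and the formula is Fubini's theorem for the lift (integral_lift_law). A
    mixed stopping time is first replaced by a measurable function with which
    it agrees off a null set (mixed_measurable_version); then nu_w is the law
    of mu(w, .) under the uniform distribution on [0, 1], and the formula is
    again Fubini's theorem (gamma_mixed).

    As the law of a random stopping time is an arbitrary law satisfying its
    defining property, it is also shown in each case that such a law exists and
    that the property fixes its values on measurable sets. *)

Set Implicit Arguments.
Unset Strict Implicit.
Unset Printing Implicit Defensive.

Import Order.TTheory GRing.Theory Num.Theory.
Import numFieldNormedType.Exports.
Local Open Scope classical_set_scope.
Local Open Scope ring_scope.

(** * Null sets *)

Section integral_off_null.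
Local Open Scope ereal_scope.
Context d (T : measurableType d) (R : realType).
Variable mu : {measure set T -> \bar R}.
Import HBNNSimple.

Let sup_simple_off_null (N : set T) (f g : T -> \bar R) :
  measurable N -> mu N = 0 -> (forall x, 0 <= g x) ->
  (forall x, ~ N x -> f x = g x) ->
  [set sintegral mu h | h in
    [set h : {nnsfun T >-> R} | forall x, (h x)%:E <= f x]] `<=`
  [set sintegral mu h | h in
    [set h : {nnsfun T >-> R} | forall x, (h x)%:E <= g x]].
Proof.
move=> mN muN g0 fg _ [h /= hf <-].
exists (proj_nnsfun h (measurableC mN)).
  move=> x; rewrite -mrestrict patchE; case: ifPn => xN //.
  by rewrite -fg//; move: xN; rewrite inE.
rewrite -(mrestrict h (measurableC mN)) -(integral_nnsfun _ (measurableC mN)).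
rewrite -setTD -(ge0_negligible_integral mN)//.
- by rewrite integral_nnsfun// patch_setT.
- by apply/measurable_EFinP/measurable_funTS.
- by move=> x _; rewrite lee_fin.
Qed.

(** The integral is a difference of suprema over simple functions, and cutting
    a simple function off on a null set does not change its integral. The
    lemma serves to replace the integrand of a mixed stopping time, measurable
    for a completion only, by a measurable one. *)
Lemma eq_integral_off_null (D N : set T) (f g : T -> \bar R) :
  measurable N -> mu N = 0 -> (forall x, D x -> ~ N x -> f x = g x) ->
  \int[mu]_(x in D) f x = \int[mu]_(x in D) g x.
Proof.
move=> mN muN fg; rewrite /integral.
have fgD x : ~ N x -> (f \_ D) x = (g \_ D) x.
  by move=> Nx; rewrite !patchE; case: ifPn => // /set_mem Dx; exact: fg.
congr (ereal_sup _ - ereal_sup _); apply/seteqP; split;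
  apply: (sup_simple_off_null mN muN); rewrite ?(funepos_ge0,funeneg_ge0)//.
- by move=> x Nx; rewrite !funeposE fgD.
- by move=> x Nx; rewrite !funeposE fgD.
- by move=> x Nx; rewrite !funenegE fgD.
- by move=> x Nx; rewrite !funenegE fgD.
Qed.

End integral_off_null.

Lemma eq_measure_off_null d (T : measurableType d) (R : realType)
    (mu : {measure set T -> \bar R}) (A B N : set T) :
  measurable A -> measurable B -> mu.-negligible N ->
  A `\` N = B `\` N -> mu A = mu B.
Proof.
move=> mA mB [M [mM M0 NM]] AB.
have le C D : measurable C -> measurable D -> C `\` N = D `\` N ->
    (mu C <= mu D)%E.
  move=> mC mD CD; rewrite -[leRHS]adde0 -M0.
  apply: (@le_trans _ _ (mu (D `|` M))); last exact: measureU2.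
  apply: le_measure; rewrite ?inE//; first exact: measurableU.
  move=> x Cx; have [/NM Mx|Nx] := pselect (N x); first by right.
  by left; have [] : (D `\` N) x by rewrite -CD.
by apply/eqP; rewrite eq_le !le.
Qed.

Lemma ae_forall_count d (T : measurableType d) (R : realType)
    (mu : {measure set T -> \bar R}) (I : countType) (Q : I -> T -> Prop) :
  (forall i, {ae mu, forall x, Q i x}) -> {ae mu, forall x, forall i, Q i x}.
Proof.
move=> aeQ.
have : \forall x \ae mu, forall n,
    if unpickle n is Some i then Q i x else True.
  by apply/ae_foralln => n; case: unpickle => [i|]; [exact: aeQ|exact: aeW].
by apply: filterS => x + i => /(_ (pickle i)); rewrite pickleK.
Qed.

(** * Measures and kernels on the line, tested on rational rays *)

Section rational_rays.
Context {R : realType}.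
Local Notation real := (measurableTypeR R).

Definition rational_rays : set (set R) :=
  range (fun q : rat => `]-oo, ratr q]%classic).

Lemma itvNyc_rational_bigcap (x : R) :
  `]-oo, x]%classic = ~` \bigcup_q
    (if x < ratr q then ~` `]-oo, ratr q]%classic else set0) :> set R.
Proof.
apply/seteqP; split => [y/= + [q _]|y/= yq].
  case: ifPn => // xq; rewrite !in_itv/= => yx; apply.
  exact: le_trans yx (ltW xq).
rewrite in_itv/= leNgt; apply/negP => /rat_in_itvoo[q].
rewrite in_itv/= => /andP[xq qy]; apply: yq; exists q => //.
by rewrite xq/= in_itv/= leNgt qy.
Qed.

Lemma measurable_rational_rays :
  @measurable _ real = <<s rational_rays >>.
Proof.
apply/seteqP; split; apply: smallest_sub.
- exact: smallest_sigma_algebra.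
- move=> _ [ab _ <-].
  have ray (x : R) : rational_rays.-sigma.-measurable (`]-oo, x]%classic : set R).
    rewrite itvNyc_rational_bigcap; apply: measurableC.
    apply: (@bigcupT_measurable_rat _ (g_sigma_algebraType rational_rays)) => q.
    case: ifPn => _; last exact: measurable0.
    by apply: measurableC; apply: sub_sigma_algebra; exists q.
  rewrite (_ : [set` _] = `]-oo, ab.2] `\` `]-oo, ab.1]).
    by apply: (@measurableD _ (g_sigma_algebraType rational_rays)); exact: ray.
  apply/seteqP; split => y/=; rewrite !in_itv/=.
    by move=> /andP[ay ->]; split => //; apply/negP; rewrite -ltNge.
  by move=> [-> /negP]; rewrite -ltNge andbT.
- exact: sigma_algebra_measurable.
- by move=> _ [q _ <-]; exact: measurable_itv.
Qed.

Lemma setI_closed_rational_rays : setI_closed rational_rays.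
Proof.
move=> _ _ [p _ <-] [q _ <-].
wlog pq : p q / p <= q.
  by move=> wl; case: (leP p q) => [|/ltW] /wl// ; rewrite setIC.
exists p => //; rewrite setIidl// => x/=; rewrite !in_itv/= => /le_trans; apply.
by rewrite ler_rat.
Qed.

(** A finite measure on the line is determined by its values on the countably
    many rays with a rational end point; the countability makes the null sets
    add up in almost-sure statements. *)
Lemma eq_measure_rational_rays (m1 m2 : {measure set real -> \bar R}) :
  (m1 setT < +oo)%E ->
  (forall q : rat, m1 `]-oo, ratr q]%classic = m2 `]-oo, ratr q]%classic) ->
  forall B, measurable B -> m1 B = m2 B.
Proof.
move=> m1oo m12 B mB.
apply: (@measure_unique _ R real rational_rays (fun n => `]-oo, ratr n%:R]%classic)).
- exact: measurable_rational_rays.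
- exact: setI_closed_rational_rays.
- by move=> n; exists n%:R.
- apply/seteqP; split => // x _; exists (Num.bound x) => //=.
  by rewrite in_itv/= ratr_nat ltW// unstable.ltr_bound.
- by move=> _ [q _ <-].
- move=> n; apply: le_lt_trans m1oo; apply: le_measure; rewrite ?inE//.
- by [].
Qed.

(** Dynkin: a family of probabilities depends measurably on the parameter as
    soon as its values on rays do. *)
Lemma measurable_kernel_rational_rays d (U : measurableType d)
  (nu : U -> probability real R) :
  (forall q : rat, measurable_fun setT (fun w => nu w `]-oo, ratr q]%classic)) ->
  forall B, measurable B -> measurable_fun setT (fun w => nu w B).
Proof.
move=> mnu B; rewrite measurable_rational_rays; move: B.
apply: dynkin_induction.
- exact: measurable_rational_rays.
- exact: setI_closed_rational_rays.
- rewrite (_ : (fun w => _) = cst 1%E)//; apply/funext => w.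
  exact: probability_setT.
- by move=> _ [q _ <-].
- move=> S mS mnuS; rewrite (_ : (fun w => _) = (fun w => 1 - nu w S)%E).
    by apply: emeasurable_funB.
  by apply/funext => w; rewrite probability_setC.
- move=> F mF tF mnuF.
  rewrite (_ : (fun w => _) = (fun w => \sum_(0 <= n <oo) nu w (F n))%E).
    by apply: ge0_emeasurable_sum.
  apply/funext => w; apply: measure_semi_bigcup => //.
  exact: bigcup_measurable.
Qed.

End rational_rays.

(** * The law mu(dx) nu_x(dy) *)

Lemma bounded_probability_integrable d (T : measurableType d) (R : realType)
    (m : probability T R) (g : T -> \bar R) (M : R) :
  measurable_fun setT g -> (forall z, `|g z| <= M%:E)%E ->
  m.-integrable setT g.
Proof.
move=> mg gM; apply/integrableP; split => //.
apply: (@le_lt_trans _ _ (\int[m]_z M%:E)%E).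
  by apply: ge0_le_integral => //; exact: measurableT_comp.
by rewrite integral_cst// [X in (_ * X)%E](@probability_setT _ _ _ m) mule1 ltry.
Qed.

Section semidirect_product.
Local Open Scope ereal_scope.
Context {R : realType} d d' (U : measurableType d) (V : measurableType d').
Variables (mu : probability U R) (nu : U -> probability V R).

(** It specializes to lift_law if nu_x depends only on the first coordinate
    of x, and to a product measure if nu is constant. *)
Definition semidirect (C : set (U * V)) : \bar R :=
  \int[mu]_x nu x (xsection C x).

Hypothesis mnu : forall B, measurable B -> measurable_fun setT (fun x => nu x B).

Let base (_ : unit) : {measure set U -> \bar R} := mu.

Let fibre : U -> {measure set V -> \bar R} := nu.

HB.instance Definition _ := isKernel.Build _ _ _ _ _ base
  (fun B _ => measurable_cst (mu B)).
HB.instance Definition _ := Kernel_isProbability.Build _ _ _ _ _ base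
  (fun=> probability_setT mu).
HB.instance Definition _ := isKernel.Build _ _ _ _ _ fibre mnu.
HB.instance Definition _ := Kernel_isProbability.Build _ _ _ _ _ fibre
  (fun x => probability_setT (nu x)).

Let graph (p : unit * U) (C : set (U * V)) : \bar R := nu p.2 (xsection C p.2).

Let graphE p : graph p = pushforward (nu p.2) (pair p.2).
Proof. by apply/funext => C; rewrite /graph xsectionE. Qed.

Let graph0 p : graph p set0 = 0.
Proof. by rewrite /graph xsection0 measure0. Qed.

Let graph_ge0 p C : 0 <= graph p C. Proof. exact: measure_ge0. Qed.

Let graph_sigma_additive p : semi_sigma_additive (graph p).
Proof.
by rewrite graphE; apply: measure_semi_sigma_additive; exact: measurable_pair1.
Qed.

HB.instance Definition _ p := isMeasure.Build _ _ _ (graph p)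
  (graph0 p) (@graph_ge0 p) (@graph_sigma_additive p).

Let graph_kernel (p : unit * U) : {measure set (U * V) -> \bar R} := graph p.

Let measurable_graph C : measurable C -> measurable_fun setT (graph_kernel ^~ C).
Proof.
move=> mC; rewrite (_ : _ ^~ _ = (fun x => fibre x (xsection C x)) \o snd).
  apply: measurableT_comp => //.
  by apply: measurable_fun_xsection_finite_kernel; rewrite inE.
by apply/funext.
Qed.

HB.instance Definition _ := isKernel.Build _ _ _ _ _ graph_kernel measurable_graph.

Let graph_setT p : graph_kernel p setT = 1.
Proof. by rewrite /= graphE /pushforward preimage_setT probability_setT. Qed.

HB.instance Definition _ := Kernel_isProbability.Build _ _ _ _ _ graph_kernel graph_setT.

(* Composition of kernels: x is drawn from mu, then a point of {x} * V from
   the image of nu_x. *)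
Let semidirect_kcomp : semidirect = kcomp base graph_kernel tt.
Proof.
by [].
Qed.

Let semidirectT : kcomp base graph_kernel tt setT = 1.
Proof.
rewrite /kcomp (eq_integral (cst 1)) => [|x _]; last exact: graph_setT.
by rewrite integral_cst// mul1e; exact: probability_setT.
Qed.

HB.instance Definition _ := Measure_isProbability.Build _ _ _
  (kcomp base graph_kernel tt) semidirectT.

Lemma semidirect_probability :
  exists m : probability (U * V)%type R, semidirect = m.
Proof. by rewrite semidirect_kcomp; exists (kcomp base graph_kernel tt). Qed.

Lemma semidirectX A B : measurable A -> measurable B ->
  semidirect (A `*` B) = \int[mu]_(x in A) nu x B.
Proof.
move=> mA mB; rewrite [RHS]integral_mkcond; apply: eq_integral => x _.
rewrite patchE; case: ifPn => xA; first by rewrite in_xsectionX.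
by rewrite notin_xsectionX// measure0.
Qed.

(** Tonelli holds for the composition of kernels; a bound makes the integrals
    of the positive and negative parts finite, so that they can be
    subtracted. *)
Lemma integral_semidirect (f : U * V -> R) (M : R) :
  measurable_fun setT f -> (forall z, `|f z| <= M)%R ->
  \int[semidirect]_z (f z)%:E = \int[mu]_x \int[nu x]_y (f (x, y))%:E.
Proof.
move=> mf fM.
have tonelli (g : U * V -> \bar R) : (forall z, 0 <= g z) ->
    measurable_fun setT g ->
    \int[semidirect]_z g z = \int[mu]_x \int[nu x]_y g (x, y).
  move=> g0 mg; rewrite semidirect_kcomp integral_kcomp//.
  apply: eq_integral => x _.
  transitivity (\int[pushforward (nu x) (pair x)]_z g z).
    by rewrite -(graphE (tt, x)).
  by rewrite ge0_integral_pushforward//; exact: measurable_pair1.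
have mEf : measurable_fun setT (EFin \o f) by exact/measurable_EFinP.
have mpos : measurable_fun setT ((EFin \o f)^\+) by exact: measurable_funepos.
have mneg : measurable_fun setT ((EFin \o f)^\-) by exact: measurable_funeneg.
have posM z : (EFin \o f)^\+ z <= M%:E.
  rewrite funeposE /= -EFin_max lee_fin ge_max (le_trans (ler_norm _) (fM z)).
  exact: le_trans (fM z).
have negM z : (EFin \o f)^\- z <= M%:E.
  rewrite funenegE /= -EFin_max lee_fin ge_max (le_trans _ (fM z)) /=.
    exact: le_trans (fM z).
  by rewrite -normrN ler_norm.
have integrable_inner (g : U * V -> \bar R) : (forall z, 0 <= g z) ->
    measurable_fun setT g -> (forall z, g z <= M%:E) ->
    mu.-integrable setT (fun x => \int[nu x]_y g (x, y)).
  move=> g0 mg gM; apply: (@bounded_probability_integrable _ _ _ mu _ M).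
    by apply: (measurable_fun_integral_finite_kernel g fibre).
  move=> x; rewrite gee0_abs ?integral_ge0//.
  apply: (@le_trans _ _ (\int[nu x]_y M%:E)).
    by apply: ge0_le_integral => //; apply: measurableT_comp => //; exact: measurable_pair1.
  by rewrite integral_cst// [X in _ * X](@probability_setT _ _ _ (nu x)) mule1.
have [m mE] := semidirect_probability; rewrite mE in tonelli *.
rewrite [LHS]integralE !tonelli//.
rewrite -integralB//; [|exact: integrable_inner..].
apply: eq_integral => x _; rewrite [RHS]integralE.
by congr (_ - _); apply: eq_integral => y _; rewrite ?funeposE ?funenegE.
Qed.

End semidirect_product.

(** * Kernels of distribution functions on [0, T] *)

Section cumulative_kernel.
Local Open Scope ereal_scope.
Context {R : realType} d (Omega : measurableType d).
Local Notation real := (measurableTypeR R).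

Lemma eq_measure_rational_cylinders
  (m1 m2 : {measure set (Omega * real) -> \bar R}) (A : set Omega) :
  measurable A -> m1 setT < +oo ->
  (forall q : rat,
    m1 (A `*` `]-oo, ratr q]%classic) = m2 (A `*` `]-oo, ratr q]%classic)) ->
  forall B, measurable B -> m1 (A `*` B) = m2 (A `*` B).
Proof.
move=> mA m1oo m12 B mB.
have mAT : measurable (A `*` setT : set (Omega * real)) by exact: measurableX.
have cylE (m : {measure set (Omega * real) -> \bar R}) C :
    m (A `*` C) = pushforward (mrestr m mAT) snd C.
  by rewrite /pushforward /mrestr; congr (m _); apply/seteqP;
    split => -[x y]/=; tauto.
rewrite !cylE; apply: eq_measure_rational_rays => //; try exact: measurable_snd.
  rewrite /= -cylE; apply: le_lt_trans m1oo; apply: le_measure; rewrite ?inE//.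
by move=> q; rewrite /= -!cylE.
Qed.

Variables (P : probability Omega R) (T : R).
Variable F : Omega -> cumulativeBounded (0:R) (1:R).
Hypothesis T0 : (0 <= T)%R.
Hypothesis F_lt0 : forall w (t : R), (t < 0)%R -> F w t = 0%R.
Hypothesis F_geT : forall w t, (T <= t)%R -> F w t = 1%R.
Hypothesis mF : forall t, measurable_fun setT (F ^~ t).

Definition cumulative_kernel (w : Omega) : probability real R :=
  lebesgue_stieltjes_measure (F w).

Lemma cumulative_kernel_ray w r : cumulative_kernel w `]-oo, r]%classic = (F w r)%:E.
Proof.
have := cdf_lebesgue_stieltjes_id (F w) r.
by rewrite /cdf /distribution /pushforward preimage_id.
Qed.

Lemma measurable_cumulative_kernel B : measurable B ->
  measurable_fun setT (fun w => cumulative_kernel w B).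
Proof.
apply: measurable_kernel_rational_rays => q.
under eq_fun do rewrite cumulative_kernel_ray.
exact/measurable_EFinP.
Qed.

Let cumulative_kernel_lt0 w : cumulative_kernel w `]-oo, 0%R[%classic = 0.
Proof.
apply/negligibleP => //.
apply: (@negligibleS _ _ _ _ (\bigcup_n (`]-oo, (- n.+1%:R^-1)%R]%classic : set real))).
  move=> x/=; rewrite in_itv/= => x0.
  exists (Num.Def.trunc (- x)^-1) => //=; rewrite in_itv/= lerNr.
  rewrite -[leRHS]invrK lef_pV2 ?posrE ?invr_gt0 ?oppr_gt0//.
  by rewrite ltW// truncnS_gt.
apply: negligible_bigcup => n; apply/negligibleP => //.
by rewrite [LHS]cumulative_kernel_ray F_lt0// oppr_lt0 invr_gt0.
Qed.

Lemma cumulative_kernel_segment w t : (0 <= t)%R ->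
  cumulative_kernel w `[0%R, t]%classic = (F w t)%:E.
Proof.
move=> t0; rewrite -cumulative_kernel_ray.
rewrite (_ : `]-oo, t]%classic = `]-oo, 0%R[ `|` `[0%R, t]); last first.
  apply/seteqP; split => x/=; rewrite !in_itv/=.
    by move=> ->; rewrite andbT; case: (ltP x 0%R); [left|right].
  by case=> [/ltW/le_trans|/andP[]//]; apply.
rewrite measureU//; first by rewrite [X in _ = X + _]cumulative_kernel_lt0 add0e.
by apply/seteqP; split => // x/=; rewrite !in_itv/= => -[x0]; rewrite leNgt x0.
Qed.

Lemma semidirect_cumulative_kernel A t : measurable A -> (0 <= t)%R ->
  semidirect P cumulative_kernel (A `*` `[0%R, t]) = \int[P]_(w in A) (F w t)%:E.
Proof.
move=> mA t0; rewrite semidirectX//.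
by under eq_integral do rewrite cumulative_kernel_segment//.
Qed.

(** The rectangles over segments that start at 0 already determine a law that
    they show to be carried by [0, T]. *)
Lemma conditional_distributions_cumulative_kernel
  (delta : probability (Omega * real)%type R) :
  (forall t, (0 <= t <= T)%R -> forall A, measurable A ->
    delta (A `*` `[0%R, t]) = \int[P]_(w in A) (F w t)%:E) ->
  conditional_distributions T P delta cumulative_kernel.
Proof.
move=> deltaE.
have [m mE] := semidirect_probability P measurable_cumulative_kernel.
have mAB A B : measurable A -> measurable B ->
    m (A `*` B) = \int[P]_(w in A) cumulative_kernel w B.
  by move=> mA mB; rewrite -mE semidirectX.
split => [B mB|w|A B mA mB].
- exact: measurable_cumulative_kernel.
- by rewrite cumulative_kernel_segment// F_geT.
- rewrite -mAB//; apply: eq_measure_rational_cylinders => //.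
    by rewrite [ltLHS]probability_setT ltry.
  move=> q; rewrite [RHS]mAB//.
  under eq_integral do rewrite cumulative_kernel_ray.
  (* The segment [0, T] carries the whole mass of delta. *)
  have supp : delta (~` (setT `*` `[0%R, T])) = 0.
    rewrite probability_setC//; last exact: measurableX.
    rewrite deltaE ?lexx ?T0//.
    under eq_integral do rewrite F_geT//.
    by rewrite integral_cst// mul1e [X in _ - X]probability_setT subee.
  have trunc : delta (A `*` `]-oo, ratr q]%classic) =
               delta (A `*` `[0%R, Num.min (ratr q) T]).
    apply/eqP; rewrite eq_le; apply/andP; split; last first.
      apply: le_measure; rewrite ?inE; [exact: measurableX|exact: measurableX|].
      by move=> [w t]/= []; rewrite !in_itv/= le_min => ? /and3P[].
    rewrite -[leRHS]adde0 -supp -measureU//; last 3 first.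
    - exact: measurableX.
    - by apply: measurableC; exact: measurableX.
    - apply/seteqP; split => // -[w t]/= [[_]]; rewrite !in_itv/= le_min.
      by move=> /and3P[-> _ ->] /not_andP[].
    apply: le_measure; rewrite ?inE; [exact: measurableX| |].
      by apply: measurableU; [|apply: measurableC]; exact: measurableX.
    move=> [w t]/= []; rewrite !in_itv/= le_min => Aw ->.
    have [tT|_] := boolP (0 <= t <= T)%R; last by right => -[].
    by left; split => //; move/andP: tT => [-> ->].
  rewrite [LHS]trunc; have [q0|q0] := ltP (ratr q : R) 0%R.
    rewrite set_itv_ge ?setX0 ?measure0; last first.
      by rewrite bnd_simp -ltNge gt_min q0.
    by rewrite integral0_eq// => w _; rewrite F_lt0.
  rewrite deltaE//; last by rewrite le_min q0 T0 ge_min lexx orbT.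
  apply: eq_integral => w _; congr EFin.
  by case: (leP (ratr q : R) T) => // Tq; rewrite !F_geT// ltW.
Qed.

End cumulative_kernel.

(** * Disintegration *)

Section ae_le.
Local Open Scope ereal_scope.
Context d (T : measurableType d) (R : realType).
Variable mu : {measure set T -> \bar R}.

Lemma ae_le_integral (f g : T -> \bar R) :
  mu.-integrable setT f -> mu.-integrable setT g ->
  (forall A, measurable A -> \int[mu]_(x in A) f x <= \int[mu]_(x in A) g x) ->
  {ae mu, forall x, f x <= g x}.
Proof.
move=> fi gi fg.
have mf := measurable_int _ fi; have mg := measurable_int _ gi.
pose E := [set x | g x < f x].
have mE : measurable E by rewrite -[E]setTI; exact: measurable_lte.
(* On E both integrals agree, hence so do the functions, almost everywhere. *)
have : ae_eq mu E f g.
  apply: integral_ae_eq => //; first exact: (integrableS measurableT mE (@subsetT _ _) fi).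
    exact: measurable_funTS.
  move=> B BE mB; apply/eqP; rewrite eq_le fg//=.
  apply: le_integral => //.
  - exact: (integrableS measurableT mB (@subsetT _ _) gi).
  - exact: (integrableS measurableT mB (@subsetT _ _) fi).
  - by move=> x /set_mem/BE/ltW.
apply: filterS => x Efg; rewrite leNgt; apply/negP => gfx.
by move: (gfx); rewrite Efg// ltxx.
Qed.

End ae_le.

Section right_infimum.
Context {R : realType} d (Omega : measurableType d) (T : R).
Variable h : rat -> Omega -> R.
Hypothesis h01 : forall q w, 0 <= h q w <= 1.
Hypothesis mh : forall q, measurable_fun setT (h q).

Let later (w : Omega) (t : R) : set R := [set h q w | q in [set q | t < ratr q]].

Let right_inf (w : Omega) (t : R) : R :=
  if t < 0 then 0 else if t < T then inf (later w t) else 1.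

Let later_neq0 w t : later w t !=set0.
Proof.
have /rat_in_itvoo[q /[!in_itv]/= /andP[tq _]] : t < t + 1 by rewrite ltrDl.
by exists (h q w); exists q.
Qed.

Let later_lb w t : lbound (later w t) 0.
Proof. by move=> _ [q _ <-]; have /andP[] := h01 q w. Qed.

Let has_inf_later w t : has_inf (later w t).
Proof. by split; [exact: later_neq0|exists 0; exact: later_lb]. Qed.

Let inf_later_le w t q : t < ratr q -> inf (later w t) <= h q w.
Proof. by move=> tq; apply: ge_inf; [exists 0; exact: later_lb|exists q]. Qed.

Let le_inf_later w t c :
  (forall q, t < ratr q -> c <= h q w) -> c <= inf (later w t).
Proof. by move=> ch; apply: lb_le_inf => // _ [q tq <-]; exact: ch. Qed.

Let inf_later01 w t : 0 <= inf (later w t) <= 1.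
Proof.
rewrite le_inf_later/=; last by move=> q _; have /andP[] := h01 q w.
have [_ [q tq _]] := later_neq0 w t.
by rewrite (le_trans (inf_later_le w tq))//; have /andP[] := h01 q w.
Qed.

Let inf_later_nd w s t : s <= t -> inf (later w s) <= inf (later w t).
Proof.
move=> st; apply: le_inf_later => q tq; apply: inf_later_le.
exact: le_lt_trans tq.
Qed.

Let right_inf_nondecreasing w : nondecreasing (right_inf w).
Proof.
move=> s t st; rewrite /right_inf.
have [s0|s0] := ltP s 0.
  have [//|t0] := ltP t 0; have [tT|//] := ltP t T.
  by have /andP[] := inf_later01 w t.
rewrite (ltNge t 0) (le_trans s0 st)/=.
have [tT|tT] := ltP t T; first by rewrite (le_lt_trans st tT) inf_later_nd.
by case: ifPn => // _; have /andP[] := inf_later01 w s.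
Qed.

Let right_inf_right_continuous w : right_continuous (right_inf w).
Proof.
move=> t.
have [t0|t0] := ltP t 0.
  have -> : right_inf w t = 0 by rewrite /right_inf t0.
  apply: cvg_near_cst; near=> u.
  have u0 : u < 0 by near: u; exact: nbhs_right_lt.
  by rewrite /right_inf u0.
have [tT|Tt] := ltP t T; last first.
  have -> : right_inf w t = 1.
    by rewrite /right_inf (ltNge t 0) (ltNge t T) t0 Tt.
  apply: cvg_near_cst; near=> u.
  have tu : t < u by near: u; exact: nbhs_right_gt.
  by rewrite /right_inf !ltNge (le_trans t0 (ltW tu)) (le_trans Tt (ltW tu)).
apply/cvgrPdist_le => e e0.
have [_ [q tq <-] hq] := inf_adherent e0 (has_inf_later w t).
near=> u.
have tu : t < u by near: u; exact: nbhs_right_gt.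
have uT : u < T by near: u; exact: nbhs_right_lt.
have uq : u < ratr q by near: u; exact: nbhs_right_lt.
rewrite distrC ger0_norm ?subr_ge0; last exact/right_inf_nondecreasing/ltW.
rewrite lerBlDl /right_inf !(ltNge _ 0) t0 (le_trans t0 (ltW tu))/= tT uT.
exact: le_trans (inf_later_le w uq) (ltW hq).
Unshelve. all: by end_near. Qed.

Let right_inf_Ny w : right_inf w @ -oo --> (0 : R).
Proof.
apply: cvg_near_cst; near=> t.
have t0 : t < 0 by near: t; exact: nbhs_ninfty_lt.
by rewrite /right_inf t0.
Unshelve. all: by end_near. Qed.

Let right_inf_y w : right_inf w @ +oo --> (1 : R).
Proof.
apply: cvg_near_cst; near=> t.
have t0 : 0 <= t by near: t; apply: nbhs_pinfty_ge; rewrite num_real.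
have tT : T <= t by near: t; apply: nbhs_pinfty_ge; rewrite num_real.
by rewrite /right_inf !ltNge t0 tT.
Unshelve. all: by end_near. Qed.

HB.instance Definition _ w := isCumulative.Build R _ R (right_inf w)
  (@right_inf_nondecreasing w) (@right_inf_right_continuous w).
HB.instance Definition _ w := isCumulativeBounded.Build R 0 1 (right_inf w)
  (right_inf_Ny w) (right_inf_y w).

Let measurable_right_inf t : measurable_fun setT (right_inf ^~ t).
Proof.
rewrite /right_inf.
have [_|t0] := ltP t 0; first exact: measurable_cst.
have [tT|_] := ltP t T; last exact: measurable_cst.
apply: (measurability _ (RGenInftyO.measurableE R)) => _ [_ [c ->] <-].
rewrite setTI (_ : _ @^-1` _ = \bigcup_(q : rat)
    (if t < ratr q then h q @^-1` `]-oo, c[ else set0)).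
  apply: bigcupT_measurable_rat => q; case: ifPn => // _.
  by rewrite -[X in measurable X]setTI; apply: mh.
apply/seteqP; split => [w/=|w [q _]].
  rewrite in_itv/= => /(inf_lt (later_neq0 w t))[_ [q tq <-] hc].
  by exists q => //; rewrite tq/= in_itv.
case: ifPn => //= tq; rewrite !in_itv/=; apply: le_lt_trans.
exact: inf_later_le.
Qed.

(** The witness is, for t in [0, T[, the infimum of the h q over the rational
    q > t. It is nondecreasing and right-continuous in t for every w, so that
    no null set of paths has to be repaired. *)
Lemma right_infimum_cumulative :
  exists F : Omega -> cumulativeBounded (0:R) (1:R),
  [/\ forall w (t : R), t < 0 -> F w t = 0,
      forall w (t : R), T <= t -> 0 <= t -> F w t = 1,
      forall t, measurable_fun setT (F ^~ t),
      forall w (t : R) q, 0 <= t < T -> t < ratr q -> F w t <= h q w &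
      forall w (t : R) c, 0 <= t < T ->
        (forall q, t < ratr q -> c <= h q w) -> c <= F w t].
Proof.
exists (fun w => right_inf w : cumulativeBounded _ _); split => /=.
- by move=> w t t0; rewrite /right_inf t0.
- by move=> w t Tt t0; rewrite /right_inf !ltNge Tt t0.
- exact: measurable_right_inf.
- by move=> w t q /andP[t0 tT] tq; rewrite /right_inf ltNge t0 tT inf_later_le.
- by move=> w t c /andP[t0 tT] ch; rewrite /right_inf ltNge t0 tT le_inf_later.
Qed.

End right_infimum.

Section disintegration.
Local Open Scope charge_scope.
Local Open Scope ereal_scope.
Context {R : realType} d (Omega : measurableType d).
Local Notation real := (measurableTypeR R).
Variables (P : probability Omega R) (T : R).
Variable delta : probability (Omega * real)%type R.
Hypothesis T0 : (0 <= T)%R.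
Hypothesis delta_support : delta (setT `*` `[0%R, T]) = 1.
Hypothesis delta_marginal : forall A, measurable A -> delta (A `*` setT) = P A.

Let slice_le_marginal A t : measurable A -> delta (A `*` `[0%R, t]) <= P A.
Proof.
move=> mA; rewrite -delta_marginal//; apply: le_measure; rewrite ?inE.
- exact: measurableX.
- exact: measurableX.
- by move=> [w s]/= [].
Qed.

Let slice_support A : measurable A -> delta (A `*` `[0%R, T]) = P A.
Proof.
move=> mA; apply/eqP; rewrite eq_le slice_le_marginal//= -delta_marginal//.
have outside : delta (~` (setT `*` `[0%R, T])) = 0.
  by rewrite probability_setC ?delta_support ?subee//; exact: measurableX.
rewrite -[leRHS]adde0 -outside -measureU//; last 3 first.
- exact: measurableX.
- by apply: measurableC; exact: measurableX.
- by apply/seteqP; split => // -[w t]/= [[_ tT]] [].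
apply: le_measure; rewrite ?inE; [exact: measurableX| |].
  by apply: measurableU; [|apply: measurableC]; exact: measurableX.
move=> [w t]/= [Aw _]; have [tT|tT] := pselect (`[0%R, T]%classic t).
  by left.
by right => -[].
Qed.

(* The Radon-Nikodym derivative of the slice at t has values in [0, 1] almost
   surely; it is clipped to have them everywhere. *)
Let segment_density (t : R) : exists f : Omega -> R,
  [/\ measurable_fun setT f, forall w, (0 <= f w <= 1)%R &
      forall A, measurable A ->
        delta (A `*` `[0%R, t]) = \int[P]_(w in A) (f w)%:E].
Proof.
pose nu := charge_of_finite_measure (slice delta t).
have numu : nu `<< P.
  apply/null_content_dominatesP => A mA PA0; apply/eqP.
  by rewrite eq_le measure_ge0 andbT -PA0; exact: slice_le_marginal.
pose D := 'd nu '/d P.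
have Di : P.-integrable setT D by exact: Radon_Nikodym_integrable.
have DE A : measurable A -> delta (A `*` `[0%R, t]) = \int[P]_(w in A) D w.
  by move=> mA; rewrite -Radon_Nikodym_integral.
have c_integrable (c : R) : P.-integrable setT (cst c%:E).
  exact: finite_measure_integrable_cst.
have D_ge0 : {ae P, forall w, cst 0%:E w <= D w}.
  apply: ae_le_integral => //.
  by move=> A mA; rewrite integral_cst// mul0e -DE.
have D_le1 : {ae P, forall w, D w <= cst 1%:E w}.
  apply: ae_le_integral => //.
  by move=> A mA; rewrite -DE// integral_cst// mul1e slice_le_marginal.
pose f w := Num.max 0%R (Num.min 1%R (fine (D w))).
have mf : measurable_fun setT f.
  apply: measurable_maxr => //; apply: measurable_minr => //.
  by apply: measurableT_comp; [exact: fine_measurable|exact: measurable_int Di].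
exists f; split => //.
  by move=> w; rewrite /f le_max lexx/= ge_max ler01 ge_min lexx.
move=> A mA; rewrite DE//; apply: ae_eq_integral => //.
- exact/measurable_funTS/measurable_int/Di.
- exact/measurable_EFinP/measurable_funTS.
apply: filterS2 D_ge0 D_le1 => w /=.
have : D w \is a fin_num by exact: Radon_Nikodym_fin_num.
rewrite /f; case: (D w) => // r _; rewrite !lee_fin/= => D0 D1 _.
by rewrite min_r// max_r.
Qed.

(** Conditional distribution functions are right limits F_t of the densities
    h_q at rational times. Almost surely h_t <= h_q for all q > t, whence
    h_t <= F_t; conversely F_t <= h_q and the continuity of delta from above
    bound the integrals of F_t by those of h_t. *)
Lemma disintegration : exists nu, conditional_distributions T P delta nu.
Proof.
have [h hP] := choice segment_density.
have mh t : measurable_fun setT (h t) by have [] := hP t.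
have h01 t w : (0 <= h t w <= 1)%R by have [_ ->] := hP t.
have hE t A : measurable A -> delta (A `*` `[0%R, t]) = \int[P]_(w in A) (h t w)%:E.
  by move=> mA; have [_ _ ->] := hP t.
have hi t : P.-integrable setT (EFin \o h t).
  apply: (@bounded_probability_integrable _ _ _ P _ 1).
    exact/measurable_EFinP.
  by move=> w /=; have /andP[h0 h1] := h01 t w; rewrite lee_fin ger0_norm.
have [F [F0 F1 mF Fle leF]] := @right_infimum_cumulative _ _ _ T
  (fun q : rat => h (ratr q)) (fun q => h01 (ratr q)) (fun q => mh (ratr q)).
exists (cumulative_kernel F).
apply: conditional_distributions_cumulative_kernel => //.
  by move=> w t Tt; apply: F1 => //; exact: le_trans Tt.
move=> t /andP[t0 tT] A mA.
have [{}tT|Tt] := ltP t T; last first.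
  have -> : t = T by apply/eqP; rewrite eq_le tT Tt.
  rewrite (eq_integral (cst 1)) => [|w _]; last by rewrite F1.
  by rewrite integral_cst// mul1e slice_support.
have mFA : measurable_fun A (fun w => (F w t)%:E).
  exact/measurable_EFinP/measurable_funTS.
have F_ge0 w : (0 <= F w t)%R.
  by apply: leF => [|q _]; [rewrite t0|have /andP[] := h01 (ratr q) w].
apply/eqP; rewrite eq_le; apply/andP; split.
  rewrite hE//; apply: ae_ge0_le_integral => //.
  - by move=> w _; rewrite lee_fin; have /andP[] := h01 t w.
  - exact/measurable_EFinP/measurable_funTS.
  - by move=> w _; rewrite lee_fin.
  - have : {ae P, forall w, forall q : rat,
        (t < ratr q)%R -> (h t w <= h (ratr q) w)%R}.
      apply: ae_forall_count => q.
      have [tq|_] := ltP t (ratr q); last exact: aeW.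
      have : {ae P, forall w, (EFin \o h t) w <= (EFin \o h (ratr q)) w}.
        apply: ae_le_integral => // B mB; rewrite -!hE//.
        apply: le_measure; rewrite ?inE; [exact: measurableX..|].
        move=> [w s]/= []; rewrite !in_itv/= => ? /andP[-> st]; split => //=.
        exact: le_trans st (ltW tq).
      by apply: filterS => w; rewrite lee_fin.
    apply: filterS => w hw _; rewrite lee_fin; apply: leF => //.
    by rewrite t0.
have segmentE : A `*` `[0%R, t] =
    \bigcap_n (A `*` `[0%R, (t + n.+1%:R^-1)%R]) :> set (Omega * real).
  apply/seteqP; split => [[w s]/= [Aw] + n _|[w s]/= sn].
    rewrite !in_itv/= => /andP[s0 st]; split => //=.
    by rewrite in_itv/= s0 (le_trans st)// lerDl invr_ge0.
  have [Aw /=] := sn 0%N I; rewrite !in_itv/= => /andP[s0 _]; split => //.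
  have : `]-oo, t]%classic s.
    rewrite (itvNycEbigcap false) => n _; have [_] := sn n I.
    by rewrite /= !in_itv/= => /andP[].
  by rewrite /= s0.
have mseg n : measurable (A `*` `[0%R, (t + n.+1%:R^-1)%R] : set (Omega * real)).
  exact: measurableX.
have : delta (A `*` `[0%R, (t + n.+1%:R^-1)%R]) @[n --> \oo] -->
       delta (A `*` `[0%R, t]).
  rewrite segmentE; apply: nonincreasing_cvg_mu => //.
  - by apply: (le_lt_trans (probability_le1 _ (mseg 0%N))); rewrite ltry.
  - by rewrite -segmentE; exact: measurableX.
  - move=> m n mn; apply/subsetPset => -[w s]/= [].
    rewrite !in_itv/= => ? /andP[-> sn]; split => //=; apply: le_trans sn _.
    by rewrite lerD2l lef_pV2 ?posrE// ler_nat.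
move/cvge_to_ge; apply; apply: nearW => n.
have /rat_in_itvoo[q /[!in_itv]/= /andP[tq qn]] : (t < t + n.+1%:R^-1)%R.
  by rewrite ltrDl invr_gt0.
apply: (@le_trans _ _ (delta (A `*` `[0%R, ratr q]))).
  rewrite hE//; apply: ge0_le_integral => //.
  - by move=> w _; rewrite lee_fin.
  - exact/measurable_EFinP/measurable_funTS.
  - by move=> w _; rewrite lee_fin; apply: Fle => //; rewrite t0.
apply: le_measure; rewrite ?inE//; first exact: measurableX.
move=> [w s]/= []; rewrite !in_itv/= => ? /andP[-> sq]; split => //=.
exact: le_trans sq (ltW qn).
Qed.

End disintegration.

(** * The iterated payoff *)

Section conditional_uniqueness.
Local Open Scope ereal_scope.
Context {R : realType} d (Omega : measurableType d).
Local Notation real := (measurableTypeR R).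
Variables (P : probability Omega R) (T : R).
Implicit Types (delta : probability (Omega * real)%type R)
  (nu : Omega -> probability real R).

Lemma conditional_distributions_marginal delta nu A :
  conditional_distributions T P delta nu -> measurable A ->
  delta (A `*` setT) = P A.
Proof.
move=> [_ _ deltaE] mA; rewrite deltaE//.
under eq_integral do rewrite probability_setT.
by rewrite integral_cst// mul1e.
Qed.

(** For a fixed Borel set both versions are densities of the same measure, so
    they agree almost surely; rational rays suffice to separate measures. *)
Lemma conditional_distributions_unique delta delta' nu nu' :
  conditional_distributions T P delta nu ->
  conditional_distributions T P delta' nu' ->
  (forall C, measurable C -> delta C = delta' C) ->
  exists N, [/\ measurable N, P N = 0 &
    forall w, ~ N w -> forall B, measurable B -> nu w B = nu' w B].
Proof.
move=> [mnu _ deltaE] [mnu' _ deltaE'] deltaC.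
have nui B : measurable B -> P.-integrable setT (fun w => nu w B).
  move=> mB; apply: (@bounded_probability_integrable _ _ _ P _ 1).
    exact: mnu.
  by move=> w; rewrite gee0_abs// probability_le1.
have : {ae P, forall w, forall q : rat,
    nu w `]-oo, ratr q]%classic = nu' w `]-oo, ratr q]%classic}.
  apply: ae_forall_count => q.
  have : ae_eq P setT (fun w => nu w `]-oo, ratr q]%classic)
                      (fun w => nu' w `]-oo, ratr q]%classic).
    apply: integral_ae_eq => //; [exact: nui|exact: mnu'|].
    move=> A _ mA; rewrite -deltaE// -deltaE'//; apply: deltaC.
    exact: measurableX.
  by apply: filterS => w; exact.
move=> [N [mN PN0 subN]]; exists N; split => // w Nw B mB.
apply: eq_measure_rational_rays => //.
  by rewrite [ltLHS]probability_setT ltry.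
move=> q; apply: contrapT => nuq; apply: Nw; apply: subN => /= nuE.
exact/nuq/nuE.
Qed.

End conditional_uniqueness.

Section iterated_payoff.
Local Open Scope ereal_scope.
Context {R : realType} d (Omega : measurableType d).
Local Notation real := (measurableTypeR R).
Variables (P : probability Omega R) (T : R).
Variables X Y Z : R -> Omega -> R.
Implicit Types (delta : probability (Omega * real)%type R)
  (nu : Omega -> probability real R).

(** The payoff of Player 1 who stops by the conditional distributions nu. *)
Definition iterated_payoff delta2 nu : \bar R :=
  \int[delta2]_(p in setT `*` `[0%R, T])
    \int[nu p.1]_(t in `[0%R, T]) (stopped_payoff X Y Z t p.1 p.2)%:E.

(** The null set where nu and nu' differ does not matter to delta2, whose
    marginal is P. *)
Lemma eq_iterated_payoff delta delta' nu nu' delta2 delta2' :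
  conditional_distributions T P delta nu ->
  conditional_distributions T P delta' nu' ->
  (forall C, measurable C -> delta C = delta' C) ->
  (forall A, measurable A -> delta2 (A `*` setT) = P A) ->
  (forall C, measurable C -> delta2 C = delta2' C) ->
  iterated_payoff delta2 nu = iterated_payoff delta2' nu'.
Proof.
move=> cond cond' deltaC marg2 delta2C.
have [N [mN PN0 nuN]] := conditional_distributions_unique cond cond' deltaC.
rewrite /iterated_payoff [RHS](eq_measure_integral delta2); last first.
  by move=> C mC _; symmetry; exact: delta2C.
apply: (@eq_integral_off_null _ _ _ _ _ (N `*` setT)).
- exact: measurableX.
- by rewrite [LHS]marg2.
- move=> [w s] _ /= Nw; apply: eq_measure_integral => B mB _.
  by apply: nuN => // Nw'; apply: Nw.
Qed.

End iterated_payoff.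

Section payoff_integrand.
Local Open Scope ereal_scope.
Context {R : realType} d (Omega : measurableType d).
Local Notation real := (measurableTypeR R).
Variable T : R.
Variables X Y Z : R -> Omega -> R.
Hypotheses (hX : payoff_process T X) (hY : payoff_process T Y)
  (hZ : payoff_process T Z).

Definition payoff_domain : set ((Omega * real) * real) :=
  (setT `*` `[0%R, T]) `*` `[0%R, T].

Definition payoff_integrand : (Omega * real) * real -> R :=
  (fun p => stopped_payoff X Y Z p.2 p.1.1 p.1.2) \_ payoff_domain.

Lemma measurable_payoff_domain : measurable payoff_domain.
Proof. by apply: measurableX => //; exact: measurableX. Qed.

Lemma measurable_payoff_integrand : measurable_fun setT payoff_integrand.
Proof.
have mD := measurable_payoff_domain.
apply/(measurable_restrict _ mD) => //; rewrite setTI.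
have fst_fst : measurable_fun setT (fun p : (Omega * real) * real => p.1.1).
  exact: measurableT_comp.
have fst_snd : measurable_fun setT (fun p : (Omega * real) * real => p.1.2).
  exact: measurableT_comp.
have mprocess U (f : (Omega * real) * real -> real) :
    payoff_process T U -> measurable_fun setT f ->
    (forall p, payoff_domain p -> `[0%R, T]%classic (f p)) ->
    measurable_fun payoff_domain (fun p => U (f p) p.1.1).
  move=> [mU _] mf fT.
  apply: (@measurable_comp _ _ _ _ _ _ (setT `*` `[0%R, T])
    (fun q : Omega * real => U q.2 q.1) _ (fun p => (p.1.1, f p))) => //.
  - exact: measurableX.
  - by move=> _ [p Dp <-]; split => //; exact: fT.
  - by apply: measurable_funTS; exact: measurable_fun_pair.
have mX : measurable_fun payoff_domain (fun p => X p.2 p.1.1).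
  by apply: mprocess => // p [].
have mY : measurable_fun payoff_domain (fun p => Y p.1.2 p.1.1).
  by apply: mprocess => // p [[]].
have mZ : measurable_fun payoff_domain (fun p => Z p.2 p.1.1).
  by apply: mprocess => // p [].
have mts : measurable_fun payoff_domain (fun p => (p.2 : R) < p.1.2)%R.
  by apply: measurable_fun_ltr; exact: measurable_funTS.
have mst : measurable_fun payoff_domain (fun p => (p.1.2 : R) < p.2)%R.
  by apply: measurable_fun_ltr; exact: measurable_funTS.
apply: measurable_fun_if => //; first exact: measurable_funS mX.
apply: measurable_fun_if; first exact: mts.
- exact: measurable_funS mst.
- by apply: measurable_funS mY => // p [[]].
- by apply: measurable_funS mZ => // p [[]].
Qed.

Lemma bounded_payoff_integrand : exists M, forall z, (`|payoff_integrand z| <= M)%R.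
Proof.
have [_ [MX bX]] := hX; have [_ [MY bY]] := hY; have [_ [MZ bZ]] := hZ.
exists (`|MX| + `|MY| + `|MZ|)%R => -[[w s] t]; rewrite /payoff_integrand patchE.
case: ifPn => [/set_mem[[/= _ + +]]|_]; last by rewrite normr0 !addr_ge0.
rewrite !in_itv/= => s0T t0T; rewrite /stopped_payoff /=.
have := bX _ w t0T; have := bY _ w s0T; have := bZ _ w t0T.
have := ler_norm MX; have := ler_norm MY; have := ler_norm MZ.
have := normr_ge0 MX; have := normr_ge0 MY; have := normr_ge0 MZ.
by case: ifPn => _; [|case: ifPn => _]; lra.
Qed.

Lemma iterated_payoffE (delta2 : probability (Omega * real)%type R)
    (nu : Omega -> probability real R) :
  iterated_payoff T X Y Z delta2 nu =
  \int[delta2]_p \int[nu p.1]_t (payoff_integrand (p, t))%:E.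
Proof.
rewrite /iterated_payoff integral_mkcond; apply: eq_integral => p _.
rewrite patchE; case: ifPn => [/set_mem pD|pD].
  rewrite integral_mkcond; apply: eq_integral => t _; rewrite /payoff_integrand !patchE.
  have -> : ((p, t) \in payoff_domain) = (t \in `[0%R, T]%classic).
    by apply/idP/idP => /set_mem => [[_ ?]|?]; apply/mem_set.
  by case: ifP.
rewrite integral0_eq// => t _; rewrite /payoff_integrand patchE ifF//.
by apply/negP => /set_mem[pD' _]; case/negP: pD; exact: mem_set.
Qed.

(** Fubini for the law of the lift of a distribution stopping time. *)
Lemma integral_lift_law (delta2 : probability (Omega * real)%type R)
    (nu : Omega -> probability real R) :
  (forall B, measurable B -> measurable_fun setT (fun w => nu w B)) ->
  \int[lift_law delta2 nu]_(p in payoff_domain)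
    (stopped_payoff X Y Z p.2 p.1.1 p.1.2)%:E = iterated_payoff T X Y Z delta2 nu.
Proof.
move=> mnu; have [M fM] := bounded_payoff_integrand.
have mnu1 B : measurable B -> measurable_fun setT (fun p : Omega * real => nu p.1 B).
  by move=> mB; apply: (measurableT_comp (mnu _ mB)).
rewrite iterated_payoffE.
rewrite -(integral_semidirect delta2 (nu := nu \o fst) mnu1
  measurable_payoff_integrand fM).
have [m mE] := semidirect_probability delta2 mnu1.
rewrite (_ : lift_law delta2 nu = semidirect delta2 (nu \o fst))//.
rewrite mE integral_mkcond; apply: eq_integral => p _.
by rewrite /payoff_integrand !patchE; case: ifP.
Qed.

End payoff_integrand.

(** * Randomized and distribution stopping times *)

Section defined_laws.
Local Open Scope ereal_scope.
Context {R : realType} (T : R) d (Omega : measurableType d)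
  (P : probability Omega R) (F : R -> set (set Omega)).
Local Notation real := (measurableTypeR R).
Hypothesis T0 : (0 < T)%R.
Hypothesis hF : usual_conditions T P F.

Lemma filtration_measurable t : (0 <= t <= T)%R -> F t `<=` measurable.
Proof.
move=> t0T A FA; rewrite (uc_generated hF); apply: sub_sigma_algebra.
by exists t.
Qed.

Lemma negligible_measurable : P.-negligible `<=` measurable.
Proof.
move=> N /(uc_null_sets hF); apply: filtration_measurable.
by rewrite lexx ltW.
Qed.

(** Null sets belong to the initial sigma-algebra, so completing adds nothing
    that is not already measurable. *)
Lemma completion_measurable t :
  (0 <= t <= T)%R -> completion P (F t) `<=` measurable.
Proof.
move=> t0T _ [A FA [N [B [FB PB0 NB]] <-]].
apply: measurableU; first exact: filtration_measurable FA.
by apply: negligible_measurable; exists B; split => //; exact: filtration_measurable FB.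
Qed.

(** The law of a random stopping time is picked by choice, hence the need to
    construct one. *)
Lemma delta_ofP (eta : random_st T P F) :
  (exists delta, defines eta delta) -> defines eta (delta_of eta).
Proof. exact: getPex. Qed.

Section randomized.
Variable rho : randomized_st T P F.

Let ext_path_Ny w : ext_path rho w @ -oo%R --> (0%R : R).
Proof.
apply: cvg_near_cst; near=> t.
have t0 : (t < 0)%R by near: t; exact: nbhs_ninfty_lt.
by rewrite /ext_path t0.
Unshelve. all: by end_near. Qed.

Let ext_path_y w : ext_path rho w @ +oo%R --> (1%R : R).
Proof.
apply: cvg_near_cst; near=> t.
have t0 : (0 <= t)%R by near: t; apply: nbhs_pinfty_ge; rewrite num_real.
have tT : (T <= t)%R by near: t; apply: nbhs_pinfty_ge; rewrite num_real.
by rewrite /ext_path !ltNge t0 tT.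
Unshelve. all: by end_near. Qed.

HB.instance Definition _ w := isCumulativeBounded.Build R 0%R 1%R (ext_path rho w)
  (ext_path_Ny w) (ext_path_y w).

Definition randomized_kernel : Omega -> probability real R :=
  cumulative_kernel (fun w => ext_path rho w : cumulativeBounded _ _).

Let ext_pathE t w : (0 <= t <= T)%R -> ext_path rho w t = rho t w.
Proof.
move=> /andP[t0 tT]; rewrite /ext_path ltNge t0/=.
case: ltP => // Tt; have -> : t = T by apply/eqP; rewrite eq_le tT Tt.
by rewrite randomized_end.
Qed.

Let ext_path_lt0 w (t : R) : (t < 0)%R -> ext_path rho w t = 0%R.
Proof. by rewrite /ext_path => ->. Qed.

Let ext_path_geT w (t : R) : (T <= t)%R -> ext_path rho w t = 1%R.
Proof. by move=> Tt; rewrite /ext_path !ltNge Tt (le_trans (ltW T0) Tt). Qed.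

Let measurable_ext_path t : measurable_fun setT (fun w => ext_path rho w t).
Proof.
have [t0|t0] := ltP t 0%R.
  by under eq_fun do rewrite ext_path_lt0//; exact: measurable_cst.
have [tT|Tt] := leP t T; last first.
  by under eq_fun do rewrite (ext_path_geT _ (ltW Tt)); exact: measurable_cst.
have t0T : (0 <= t <= T)%R by rewrite t0.
under eq_fun do rewrite ext_pathE//.
move=> _ B mB; rewrite setTI.
exact: (completion_measurable t0T (randomized_adapted rho t0T mB)).
Qed.

(** P(dw) nu_w(dt) is a law that rho defines, and every such law disintegrates
    in this way since its values on segments are prescribed. *)
Lemma conditional_distributions_randomized :
  conditional_distributions T P (delta_of (Randomized rho)) randomized_kernel.
Proof.
have T0' := ltW T0.
apply: conditional_distributions_cumulative_kernel => //.
have : defines (Randomized rho) (delta_of (Randomized rho)).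
  apply: delta_ofP.
  have [m mE] := semidirect_probability P
    (measurable_cumulative_kernel
       (F := fun w => ext_path rho w : cumulativeBounded _ _) measurable_ext_path).
  exists m => t t0T A mA; rewrite -mE semidirect_cumulative_kernel//.
    by apply: eq_integral => w _; rewrite /= ext_pathE.
  by case/andP: t0T.
move=> deltaE t t0T A mA; rewrite deltaE//.
by apply: eq_integral => w _; rewrite /= ext_pathE.
Qed.

Lemma gamma_randomized X Y Z tau2 :
  gamma X Y Z (Randomized rho) tau2 =
  iterated_payoff T X Y Z (delta_of tau2) randomized_kernel.
Proof. by []. Qed.

End randomized.

Section distribution.
Variable law : distribution_st T P F.

Lemma conditional_distributions_conditional :
  conditional_distributions T P law (conditional T P law).
Proof.
apply: getPex; apply: disintegration; first exact: ltW.
- exact: distribution_support.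
- exact: distribution_marginal.
Qed.

Lemma conditional_distributions_distribution :
  conditional_distributions T P (delta_of (Distribution law)) (conditional T P law).
Proof.
have deltaE : defines (Distribution law) (delta_of (Distribution law)).
  by apply: delta_ofP; exists law.
have [mnu nuT lawE] := conditional_distributions_conditional.
split => // A B mA mB; rewrite deltaE; [exact: lawE|exact: measurableX].
Qed.

Lemma gamma_distribution X Y Z tau2 :
  payoff_process T X -> payoff_process T Y -> payoff_process T Z ->
  gamma X Y Z (Distribution law) tau2 =
  iterated_payoff T X Y Z (delta_of tau2) (conditional T P law).
Proof.
move=> hX hY hZ; rewrite -integral_lift_law//.
by have [] := conditional_distributions_conditional.
Qed.

End distribution.
End defined_laws.

(** * Mixed stopping times *)

Section unit_law.
Context {R : realType}.
Local Notation real := (measurableTypeR R).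

Definition unit_law : set real -> \bar R :=
  mrestr (@lebesgue_measure R) (measurable_itv `[0%R, 1%R]).

HB.instance Definition _ := Measure.on unit_law.

Let unit_lawT : unit_law setT = 1%E.
Proof.
by rewrite /unit_law /mrestr setTI lebesgue_measure_itv/= lte01 oppr0 adde0.
Qed.

HB.instance Definition _ :=
  Measure_isProbability.Build _ _ _ unit_law unit_lawT.

End unit_law.

Section mixed.
Local Open Scope ereal_scope.
Context {R : realType} (T : R) d (Omega : measurableType d)
  (P : probability Omega R) (F : R -> set (set Omega)).
Local Notation real := (measurableTypeR R).
Local Notation lebesgue := (@lebesgue_measure R).
Hypothesis T0 : (0 < T)%R.
Hypothesis hF : usual_conditions T P F.
Variable mu : mixed_st T P F.

Let strip : set (Omega * real) := setT `*` `[0%R, 1%R].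

Let measurable_strip : measurable strip.
Proof. exact: measurableX. Qed.

Lemma prod_unit_measurable t : (0 <= t <= T)%R -> prod_unit F t `<=` measurable.
Proof.
move=> t0T; apply: smallest_sub.
  split => [//|A mA|A mA]; first exact: measurableD.
  exact: bigcupT_measurable.
move=> _ [A FA [B [mB _] <-]]; apply: measurableX => //.
exact: (filtration_measurable hF t0T FA).
Qed.

(* The measurability of mu concerns levels in [0, T]; at any other level the
   sublevel set is empty or the whole strip. *)
Let sublevel (q : rat) : exists AN : set (Omega * real) * set (Omega * real),
  [/\ measurable AN.1, measurable AN.2, (P \x lebesgue) AN.2 = 0 &
      forall p, strip p -> ~ AN.2 p -> (mu p.1 p.2 <= ratr q)%R <-> AN.1 p].
Proof.
have [q0|q0] := ltP (ratr q) (0 : R)%R.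
  exists (set0, set0); split => //= p [_ /= p1] _; split => //.
  have /andP[mu0 _] := mixed_range mu p.1 p1.
  by move=> /(le_trans mu0); rewrite leNgt q0.
have [qT|Tq] := leP (ratr q) T; last first.
  exists (setT, set0); split => //= p [_ /= p1] _; split => // _.
  have /andP[_ muT] := mixed_range mu p.1 p1.
  exact: le_trans muT (ltW Tq).
have q0T : (0 <= (ratr q : R) <= T)%R by rewrite q0.
have [A FA [N [B [FB B0 NB]] AN]] := mixed_measurable mu q0T.
exists (A, B); split => /=.
- exact: (prod_unit_measurable q0T FA).
- exact: (prod_unit_measurable q0T FB).
- exact: B0.
- move=> p [_ /= p1] Bp; have /= := congr1 (fun S => S p) AN => SE.
  split => [mup|Ap].
    by have : (A `|` N) p; [rewrite /= SE|case=> // /NB].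
  by have : (A `|` N) p; [left|rewrite /= SE => -[]].
Qed.

(** mu agrees off a measurable null set with a measurable function: the
    rational sublevel sets are measurable up to countably many null sets. *)
Lemma mixed_measurable_version : exists (m : Omega * real -> real) N,
  [/\ measurable_fun setT m, forall p, (0 <= (m p : R) <= T)%R, measurable N,
      (P \x lebesgue) N = 0 & forall p, strip p -> ~ N p -> m p = mu p.1 p.2].
Proof.
have [AN ANP] := choice sublevel.
pose N := \bigcup_q (AN q).2.
have mN : measurable N.
  by apply: bigcupT_measurable_rat => q; have [] := ANP q.
have N0 : (P \x lebesgue) N = 0.
  apply/negligibleP => //.
  have : {ae (P \x lebesgue), forall p, forall q, ~ (AN q).2 p}.
    apply: ae_forall_count => q; have [_ mAN AN0 _] := ANP q.
    by exists (AN q).2; split => // p /= /contrapT.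
  by apply: negligibleS => p [q _ Nq] /= /(_ q).
pose G := strip `\` N.
have mG : measurable G by exact: measurableD.
exists ((fun p => mu p.1 p.2 : real) \_ G), N; split => //.
- apply/(measurable_restrict _ mG) => //; rewrite setTI.
  apply: (measurability _ (RGenInftyO.measurableE R)) => _ [_ [c ->] <-].
  rewrite (_ : _ `&` _ = G `&` \bigcup_(q : rat)
      (if (ratr q < c)%R then (AN q).1 else set0)).
    apply: measurableI => //; apply: bigcupT_measurable_rat => q.
    by case: ifPn => // _; have [] := ANP q.
  have sub q p : G p -> (mu p.1 p.2 <= ratr q)%R <-> (AN q).1 p.
    move=> [Sp Np]; have [_ _ _ /(_ p Sp)] := ANP q; apply => Nq.
    by apply: Np; exists q.
  apply/seteqP; split => p /= [Gp].
    rewrite in_itv/= => /rat_in_itvoo[q /[!in_itv]/= /andP[muq qc]].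
    split => //; exists q => //; rewrite qc.
    by apply/(sub q p Gp); exact: ltW.
  move=> [q _]; case: ifPn => // qc /(sub q p Gp) muq.
  by split => //; rewrite in_itv/=; exact: le_lt_trans muq qc.
- move=> p; rewrite patchE; case: ifPn => [/set_mem[[_ p1] _]|_].
    exact: mixed_range.
  by rewrite lexx ltW.
- by move=> p Sp Np; rewrite patchE ifT//; apply/mem_set.
Qed.

End mixed.

Section mixed_law.
Local Open Scope ereal_scope.
Context {R : realType} (T : R) d (Omega : measurableType d)
  (P : probability Omega R) (F : R -> set (set Omega)).
Local Notation real := (measurableTypeR R).
Local Notation lebesgue := (@lebesgue_measure R).
Variable mu : mixed_st T P F.
Variables (m : Omega * real -> real) (N : set (Omega * real)).
Hypothesis mm : measurable_fun setT m.
Hypothesis mT : forall p, (0 <= (m p : R) <= T)%R.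
Hypothesis mN : measurable N.
Hypothesis N0 : (P \x lebesgue) N = 0.

Let strip : set (Omega * real) := setT `*` `[0%R, 1%R].

Hypothesis mE : forall p, strip p -> ~ N p -> m p = mu p.1 p.2.

Let measurable_strip : measurable strip.
Proof. exact: measurableX. Qed.

Let section (w : Omega) (r : real) : real := m (w, r).

Let measurable_section w : measurable_fun setT (section w).
Proof. by apply: (measurableT_comp mm); exact: measurable_pair1. Qed.

HB.instance Definition _ w :=
  isMeasurableFun.Build _ _ _ _ (section w) (@measurable_section w).

(** The law of m(w, .) under the uniform distribution on [0, 1]. *)
Definition mixed_kernel (w : Omega) : probability real R :=
  distribution (unit_law : probability real R) (section w).

Let version_event (C : set (Omega * real)) : set (Omega * real) :=
  strip `&` [set p | C (p.1, m p)].

Let measurable_version_event C : measurable C -> measurable (version_event C).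
Proof.
move=> mC; apply: measurableI => //; rewrite -[X in measurable X]setTI.
by apply: (measurable_fun_pair measurable_fst mm).
Qed.

Let xsection_version_event C w :
  lebesgue (xsection (version_event C) w) = mixed_kernel w (xsection C w).
Proof.
rewrite /mixed_kernel /distribution /pushforward /= /unit_law /mrestr.
congr lebesgue; rewrite !xsectionE.
by apply/seteqP; split => r /=; [case=> [[_ r1] Cr]|case=> Cr r1]; split.
Qed.

Lemma measurable_mixed_kernel B : measurable B ->
  measurable_fun setT (fun w => mixed_kernel w B).
Proof.
move=> mB; rewrite (_ : (fun w => _) =
    lebesgue \o xsection (version_event (setT `*` B))).
  by apply: measurable_fun_xsection; apply: measurable_version_event; exact: measurableX.
by apply/funext => w; rewrite /= xsection_version_event in_xsectionX// inE.
Qed.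

Let measure_version_event C : measurable C ->
  (P \x lebesgue) (version_event C) = semidirect P mixed_kernel C.
Proof. by move=> mC; apply: eq_integral => w _ /=; rewrite xsection_version_event. Qed.

Let mixed_event (C : set (Omega * real)) : set (Omega * real) :=
  [set p | (0 <= (p.2 : R) <= 1)%R /\ C (p.1, mu p.1 p.2)].

Let mixed_version_event C p : ~ N p -> mixed_event C p <-> version_event C p.
Proof.
move=> Np; split => [[p1 Cp]|[Sp Cp]].
  have Sp : strip p by split.
  by split => //=; rewrite mE.
by split; [have [] := Sp|rewrite -mE].
Qed.

(** The events that define the law of mu differ from those of its measurable
    version m by subsets of N only. Hence P(dw) nu_w(dt) is a law that mu
    defines, and any other one has the same values, since the measure of the
    measurable part of a set does not depend on its decomposition. *)
Lemma conditional_distributions_mixed :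
  conditional_distributions T P (delta_of (Mixed mu)) mixed_kernel.
Proof.
have : defines (Mixed mu) (delta_of (Mixed mu)).
  apply: delta_ofP.
  have [l lE] := semidirect_probability P measurable_mixed_kernel.
  exists l => C mC; exists (version_event C `\` N), (mixed_event C `&` N); split.
  - by apply: measurableD => //; exact: measurable_version_event.
  - by exists N; split => // p [].
  - apply/seteqP; split => [p Cp|p [[Cp Np]|[]//]].
      have [Np|Np] := pselect (N p); first by right.
      by left; split => //; apply/mixed_version_event.
    exact/mixed_version_event.
  - rewrite -lE -measure_version_event//; apply: (eq_measure_off_null (N := N)).
    + exact: measurable_version_event.
    + by apply: measurableD => //; exact: measurable_version_event.
    + exact/negligibleP.
    + by rewrite setDDl setUid.
move=> def; split => [|w|A B mA mB]; first exact: measurable_mixed_kernel.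
- rewrite -(probability_setT (unit_law : probability real R)).
  congr (unit_law _).
  by apply/seteqP; split => // r _; rewrite /= in_itv/= mT.
- have mAB : measurable (A `*` B : set (Omega * real)) by exact: measurableX.
  have [A' [N' [mA' N'0 AE ->]]] := def _ mAB.
  rewrite -semidirectX//.
  rewrite -measure_version_event//.
  apply: (eq_measure_off_null (N := N `|` N')) => //.
  + exact: measurable_version_event.
  + by apply: negligibleU => //; exact/negligibleP.
  + have A'_event p : ~ (N `|` N') p -> A' p <-> version_event (A `*` B) p.
      move=> /not_orP[Np N'p]; rewrite -mixed_version_event// /mixed_event AE.
      by split => [|[]//]; left.
    by apply/seteqP; split => p [Ap Np]; split => //; apply/(A'_event p).
Qed.

Variables X Y Z : R -> Omega -> R.
Hypotheses (hX : payoff_process T X) (hY : payoff_process T Y)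
  (hZ : payoff_process T Z).

(** As delta2 has marginal P, the set of the ((w, s), r) with (w, r) in N is
    null for its product with lambda, so mu can be replaced by m; then Fubini
    applies, and the integral over r is the integral of nu_w. *)
Lemma gamma_mixed (tau2 : random_st T P F) :
  (forall A, measurable A -> delta_of tau2 (A `*` setT) = P A) ->
  gamma X Y Z (Mixed mu) tau2 =
  iterated_payoff T X Y Z (delta_of tau2) mixed_kernel.
Proof.
set delta2 := delta_of tau2 => marg2.
pose uniform : Omega * real -> probability real R := fun=> unit_law.
have muniform B : measurable B -> measurable_fun setT (fun p => uniform p B).
  by move=> _; exact: measurable_cst.
have [sd sdE] := semidirect_probability delta2 muniform.
(* Inside [0, 1] the product with Lebesgue measure is the product with the
   uniform law. *)
have sd_lebesgue (A : set ((Omega * real) * real)) :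
    measurable A -> A `<=` setT `*` `[0%R, 1%R] ->
    (delta2 \x lebesgue) A = sd A.
  move=> mA A1; rewrite -sdE; apply: eq_integral => p _ /=.
  rewrite /unit_law /mrestr; congr lebesgue; rewrite xsectionE.
  by apply/seteqP; split => [r Ar|r []//]; split => //; have [] := A1 _ Ar.
pose m2 (q : (Omega * real) * real) := m (q.1.1, q.2).
have mm2 : measurable_fun setT m2.
  apply: (measurableT_comp mm); apply: measurable_fun_pair => //.
  exact: measurableT_comp.
have [M fM] := bounded_payoff_integrand hX hY hZ.
have mf := measurable_payoff_integrand hX hY hZ.
pose g (q : (Omega * real) * real) := payoff_integrand T X Y Z (q.1, m2 q).
have mg : measurable_fun setT g.
  by apply: (measurableT_comp mf); exact: measurable_fun_pair.
pose N2 : set ((Omega * real) * real) :=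
  [set q | N (q.1.1, q.2)] `|` (setT `*` ~` `[0%R, 1%R]).
have mN2 : measurable N2.
  apply: measurableU; last by apply: measurableX => //; exact: measurableC.
  rewrite -[X in measurable X]setTI.
  have m12 : measurable_fun setT (fun q : (Omega * real) * real => (q.1.1, q.2)).
    by apply: measurable_fun_pair => //; exact: measurableT_comp.
  exact: m12.
have sdN2 : sd N2 = 0.
  have [N' [mN' PN'0 subN']] : ae_eq P setT (lebesgue \o xsection N) (cst 0).
    apply/ae_eq_integral_abs => //; first exact: measurable_fun_xsection.
    rewrite -[RHS]N0; apply: eq_integral => w _ /=.
    by rewrite gee0_abs.
  rewrite -sdE -[RHS](integral0 delta2 setT).
  apply: (@eq_integral_off_null _ _ _ _ _ (N' `*` setT)).
  - exact: measurableX.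
  - by rewrite [LHS]marg2.
  - move=> [w s] _ /= N'w; apply: (@subset_measure0 _ _ _ lebesgue _ (xsection N w)).
    + by apply: measurableI => //; exact: measurable_xsection.
    + exact: measurable_xsection.
    + by rewrite !xsectionE => r [/= [//|[_ /=]]].
    + apply: contrapT => wN0; apply: N'w; split => //; apply: subN' => /= H.
      exact/wN0/H.
transitivity (\int[sd]_q (g q)%:E).
  rewrite /gamma -/delta2 (eq_measure_integral sd); last first.
    by move=> A mA AD; apply: sd_lebesgue => // -[p r] /AD[].
  rewrite integral_mkcond; apply: (eq_integral_off_null mN2 sdN2).
  (* Where s is outside [0, T] both integrands vanish. *)
  move=> [[w s] r] _ /not_orP[/= Nwr] /not_andP[//|/contrapT r1].
  have mwr : m (w, r) = mu w r by exact: mE.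
  rewrite /g /payoff_integrand /m2 !patchE/= -mwr.
  have [sT|sT] := pselect (`[0%R, T]%classic s).
    rewrite !ifT//; apply/mem_set; split => //.
    by rewrite /= in_itv/= mT.
  by rewrite !ifF//; apply/negP => /set_mem[[]].
rewrite iterated_payoffE -sdE.
rewrite (integral_semidirect delta2 muniform mg (M := M)); last first.
  by move=> q; exact: fM.
apply: eq_integral => p _.
have mfp : measurable_fun setT (fun t => (payoff_integrand T X Y Z (p, t))%:E).
  apply/measurable_EFinP; apply: (measurableT_comp mf).
  exact: measurable_pair1.
rewrite [RHS]integral_distribution//.
apply: (@bounded_probability_integrable _ _ _ _ _ M).
  exact: (measurableT_comp mfp).
by move=> r /=; rewrite lee_fin fM.
Qed.

End mixed_law.

(** * Invariance of the payoff *)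

(** Any random stopping time enters the payoff through the conditional
    distributions of the law that it defines. *)
Lemma gamma_iterated_payoff {R : realType} (T : R) (T0 : 0 < T)
  d (Omega : measurableType d) (P : probability Omega R)
  (F : R -> set (set Omega)) (hF : usual_conditions T P F)
  (X Y Z : R -> Omega -> R) (hX : payoff_process T X)
  (hY : payoff_process T Y) (hZ : payoff_process T Z) (tau : random_st T P F) :
  exists nu, conditional_distributions T P (delta_of tau) nu /\
    forall tau2 : random_st T P F,
      (forall A, measurable A -> delta_of tau2 (A `*` setT) = P A) ->
      gamma X Y Z tau tau2 = iterated_payoff T X Y Z (delta_of tau2) nu.
Proof.
case: tau => [mu|rho|law].
- have [m [N [mm mT mN N0 mE]]] := mixed_measurable_version T0 hF mu.
  exists (mixed_kernel mm); split.
    exact: (conditional_distributions_mixed mm mT mN N0 mE).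
  by move=> tau2; exact: (gamma_mixed mm mT mN N0 mE).
- exists (randomized_kernel rho); split.
    exact: conditional_distributions_randomized.
  by move=> tau2 _; exact: gamma_randomized.
- exists (conditional T P law); split.
    exact: conditional_distributions_distribution.
  by move=> tau2 _; exact: gamma_distribution.
Qed.

Theorem mainTheorem5 (R : realType) (T : R) (hT : 0 < T)
  (d : measure_display) (Omega : measurableType d) (P : probability Omega R)
  (F : R -> set (set Omega)) (hF : usual_conditions T P F)
  (X Y Z : R -> Omega -> R)
  (hX : payoff_process T X) (hY : payoff_process T Y) (hZ : payoff_process T Z)
  (tau1 tau1' tau2 tau2' : random_st T P F) :
  equivalent tau1 tau1' -> equivalent tau2 tau2' ->
  gamma X Y Z tau1 tau2 = gamma X Y Z tau1' tau2'.
Proof.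
move=> tau1E tau2E.
have payoffP := gamma_iterated_payoff hT hF hX hY hZ.
have marginal (tau : random_st T P F) A :
    measurable A -> delta_of tau (A `*` setT) = P A.
  move=> mA; have [nu [nuP _]] := payoffP tau.
  exact: conditional_distributions_marginal nuP mA.
have [nu [nuP ->]] := payoffP tau1; last by move=> *; exact: marginal.
have [nu' [nuP' ->]] := payoffP tau1'; last by move=> *; exact: marginal.
apply: (eq_iterated_payoff _ _ _ nuP nuP') => //.
by move=> A mA; exact: marginal.
Qed.
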